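(* Let $u(t)=u(\boldsymbol{x}(t,\boldsymbol{x}_0))$, $t\in[0,T]$, be a real-valued, square-integrable observable of a dynamical system in statistical equilibrium, satisfying the Mori-Zwanzig equation $$\frac{du(t)}{dt}=\Omega\,u(t)+\int_0^t K(t-s)\,u(s)\,ds+f(t),$$ with $\Omega$, $K(t)$ and $f(t)$ as defined in the context. Then for any bi-orthogonal (Karhunen-Loève) series expansion of the solution of this equation, $$u(t)=\overline{u}+\sum_{k=1}^{R}\sqrt{\lambda_k}\,\xi_k\,e_k(t),\qquad t\in[0,T],$$ there exists a unique series expansion of the fluctuation term $f(t)$ of the form $$f(t)=\overline{f}+\sum_{k=1}^{R}\sqrt{\lambda_k}\,\xi_k\,h_k(t),$$ with the same $\lambda_k$ and $\xi_k$, and with (deterministic) temporal modes $h_1(t),\dots,h_R(t)$.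
   Context: Dynamical system: $\frac{d\boldsymbol{x}}{dt}=\boldsymbol{F}(\boldsymbol{x})$, $\boldsymbol{x}(0)=\boldsymbol{x}_0$, evolves on a smooth manifold $\mathcal{M}\subseteq\mathbb{R}^N$, with flow $\boldsymbol{x}(t,\boldsymbol{x}_0)$. It is in statistical equilibrium: there is an equilibrium distribution $\rho_{eq}$ on $\mathcal{M}$ (more generally an invariant measure), and $\boldsymbol{x}_0$ is sampled from it. Write $\langle g\rangle_{eq}=\int_{\mathcal{M}}g\,\rho_{eq}\,d\boldsymbol{x}$ and $\langle f,g\rangle_{eq}=\int_{\mathcal{M}}f g\,\rho_{eq}\,d\boldsymbol{x}$ for the inner product of $L^2(\mathcal{M},\rho_{eq})$. The Liouville operator is $\mathcal{L}=\sum_{k=1}^N F_k(\boldsymbol{x}_0)\,\partial/\partial x_{0k}$, so that $u(t)=e^{t\mathcal{L}}u(0)$ with $u(0)=u(\boldsymbol{x}_0)$. Mori's projection is $\mathcal{P}g=\frac{\langle g,u(0)\rangle_{eq}}{\langle u(0),u(0)\rangle_{eq}}\,u(0)$, and $\mathcal{Q}=\mathcal{I}-\mathcal{P}$, where $\mathcal{I}$ is the identity. In the Mori-Zwanzig equation, $$\Omega=\frac{\langle u(0),\mathcal{L}u(0)\rangle_{eq}}{\langle u(0),u(0)\rangle_{eq}},\qquad K(t)=\frac{\langle u(0),\mathcal{L}f(t)\rangle_{eq}}{\langle u(0),u(0)\rangle_{eq}},\qquad f(t)=e^{t\mathcal{Q}\mathcal{L}}\mathcal{Q}\mathcal{L}u(0).$$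 $f(t)$ is called the fluctuation term and $K(t)$ the memory kernel. Bi-orthogonal (Karhunen-Loève) expansion of $u$: $\overline{u}$ is the mean of $u(t)$ with respect to the equilibrium distribution; $\{\xi_1,\dots,\xi_R\}$ are uncorrelated random variables, $\langle\xi_i\xi_j\rangle_{eq}=\delta_{ij}$; and $(\lambda_k,e_k(t))$, $k=1,\dots,R$, are the eigenvalues and eigenfunctions of $$\int_0^T\langle u(t)u(s)\rangle_{eq}\,e_k(s)\,ds=\lambda_k e_k(t),\qquad t\in[0,T].$$ The variables $\xi_k$ and modes $e_k$ are related (for zero-mean $u$) by $\xi_k=\frac{1}{\sqrt{\lambda_k}}\int_0^T u(t)e_k(t)\,dt$ and $e_k(t)=\langle u(t)\xi_k\rangle_{eq}/\sqrt{\lambda_k}$; in particular each $\xi_k$ is a function of $\boldsymbol{x}_0$. $\overline{f}$ denotes the mean $\langle f(t)\rangle_{eq}$ of the fluctuation term. *)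

(* Defs.v *)
From HB Require Import structures.
From mathcomp Require Import all_boot all_order all_algebra.
From mathcomp Require Import all_classical all_reals all_analysis.

Set Implicit Arguments.
Unset Strict Implicit.
Unset Printing Implicit Defensive.

Import Order.TTheory GRing.Theory Num.Theory.
Import numFieldNormedType.Exports.

Local Open Scope classical_set_scope.
Local Open Scope ring_scope.

(* Elements of L^2(P) are represented by square-integrable measurable
   functions; equality in L^2(P) is equality P-almost everywhere. *)
Section L2.
Context {d : measure_display} {X : measurableType d} {R : realType}.
Variable P : probability X R.

Definition L2 (g : X -> R) : Prop := g \in Lfun P 2%:E.

Definition L2_norm (g : X -> R) : \bar R := ('N[P]_2%:E[EFin \o g])%E.

Definition mean (g : X -> R) : R := \int[P]_x g x.

Definition inner (f g : X -> R) : R := \int[P]_x (f x * g x).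

Definition L2_cvg {I : Type} (G : set_system I) (v : I -> X -> R) (g : X -> R) :
    Prop :=
  [/\ L2 g, \forall i \near G, L2 (v i) &
      L2_norm (fun x => v i x - g x) @[i --> G] --> 0%E].

(* At an end point of an interval D this is the one-sided derivative. *)
Definition L2_deriv_within (D : set R) (v : R -> X -> R) (t : R) (w : X -> R) :
    Prop :=
  L2_cvg (within D t^') (fun s => (s - t)^-1 *: (v s - v t)) w.

Record C0_semigroup (S : R -> (X -> R) -> (X -> R)) : Prop := {
  semigroup_L2 : forall t g, 0 <= t -> L2 g -> L2 (S t g) ;
  semigroup_linear : forall t a g h, 0 <= t -> L2 g -> L2 h ->
    {ae P, forall x, S t (a *: g + h) x = a * S t g x + S t h x} ;
  semigroup_bounded : forall t, 0 <= t -> exists C : R, forall g, L2 g ->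
    (L2_norm (S t g) <= C%:E * L2_norm g)%E ;
  semigroup_0 : forall g, L2 g -> {ae P, forall x, S 0 g x = g x} ;
  semigroup_D : forall s t g, 0 <= s -> 0 <= t -> L2 g ->
    {ae P, forall x, S (s + t) g x = S s (S t g) x} ;
  semigroup_continuous : forall g, L2 g -> L2_cvg 0^'+ (S ^~ g) g }.

(* S t = e^{tA}: S is the strongly continuous semigroup whose infinitesimal
   generator is the (unbounded) operator A with domain domA. *)
Definition exp_semigroup (domA : set (X -> R)) (A : (X -> R) -> (X -> R))
    (S : R -> (X -> R) -> (X -> R)) : Prop :=
  C0_semigroup S /\
  forall g h, L2 g -> L2 h ->
    (L2_cvg 0^'+ (fun t => t^-1 *: (S t g - g)) h <->
     domA g /\ {ae P, forall x, A g x = h x}).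

Definition mori_proj (u0 g : X -> R) : X -> R :=
  (inner g u0 / inner u0 u0) *: u0.

Definition mori_orth (u0 g : X -> R) : X -> R := g - mori_proj u0 g.

(* The number of modes is r for Some r and infinite for None. *)
Definition is_mode (rk : option nat) (k : nat) : bool :=
  if rk is Some r then (k < r)%N else true.

(* g(t) = mean of g(t) + sum_k sqrt(lam_k) xi_k m_k(t) in L^2(P), for all t in
   [0, T]; with finitely many modes the partial sums are eventually constant,
   and this is P-almost sure equality with the finite sum. *)
Definition series_expansion (T : R) (rk : option nat) (lam : nat -> R)
    (xi : nat -> X -> R) (m : nat -> R -> R) (g : R -> X -> R) : Prop :=
  forall t, t \in `[0, T] ->
    L2_cvg \oo
      (fun n x => mean (g t) +
         \sum_(k < n | is_mode rk k) Num.sqrt (lam k) * xi k x * m k t)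
      (g t).

Definition centered (u : R -> X -> R) (t : R) (x : X) : R := u t x - mean (u t).

(* The correlation kernel and the two relations between xi_k and e_k are those
   of the fluctuation u - <u>; for zero-mean u, centered u is u. *)
Record karhunen_loeve (T : R) (u : R -> X -> R) (rk : option nat)
    (lam : nat -> R) (xi : nat -> X -> R) (e : nat -> R -> R) : Prop := {
  kl_lam_gt0 : forall k, is_mode rk k -> 0 < lam k ;
  kl_xi_L2 : forall k, is_mode rk k -> L2 (xi k) ;
  kl_xi_orthonormal : forall i j, is_mode rk i -> is_mode rk j ->
    inner (xi i) (xi j) = (i == j)%:R ;
  kl_e_measurable : forall k, is_mode rk k ->
    measurable_fun (`[0, T] : set R) (e k) ;
  kl_e_L2 : forall k, is_mode rk k ->
    lebesgue_measure.-integrable `[0, T] (fun t => (e k t ^+ 2)%:E) ;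
  kl_eigen : forall k, is_mode rk k -> forall t, t \in `[0, T] ->
    \int[lebesgue_measure]_(s in `[0, T])
      (inner (centered u t) (centered u s) * e k s) = lam k * e k t ;
  kl_xiE : forall k, is_mode rk k ->
    {ae P, forall x, xi k x = (Num.sqrt (lam k))^-1 *
       \int[lebesgue_measure]_(t in `[0, T]) (centered u t x * e k t)} ;
  kl_eE : forall k, is_mode rk k -> forall t, t \in `[0, T] ->
    e k t = inner (centered u t) (xi k) / Num.sqrt (lam k) ;
  kl_expansion : series_expansion T rk lam xi e u }.

(* du/dt = Omega u(t) + int_0^t K(t - s) u(s) ds + f(t) in L^2(P), the memory
   integral being taken pointwise on X. *)
Definition mori_zwanzig_eq (T Omega : R) (K : R -> R) (f u : R -> X -> R) :
    Prop :=
  lebesgue_measure.-integrable `[0, T] (EFin \o K) /\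
  forall t, t \in `[0, T] ->
    L2_deriv_within `[0, T] u t
      (fun x => Omega * u t x
         + (\int[lebesgue_measure]_(s in `[0, t]) (K (t - s) * u s x))
         + f t x).

End L2.

Section Smooth.
Context {R : realType}.

(* C^oo on the open set U: all iterated directional derivatives are
   differentiable there. *)
Definition smooth_on (V W : normedModType R) (U : set V) (g : V -> W) : Prop :=
  forall vs : seq V, forall x, U x ->
    differentiable (foldr (fun v k => 'D_v k) g vs) x.

(* Embedded submanifold of R^N, as a local regular zero set. *)
Definition submanifold (N : nat) (M : set 'rV[R]_N) : Prop :=
  exists m : nat, forall p, M p ->
    exists (U : set 'rV[R]_N) (g : 'rV[R]_N -> 'rV[R]_m),
      [/\ open U, U p, smooth_on U g,
          M `&` U = [set x | U x /\ g x = 0] &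
          forall x, M x -> U x -> forall w, exists v, 'd g x v = w].

End Smooth.

(* R^N with its Borel sigma-algebra. *)
Definition phase (R : realType) (N : nat) :=
  g_sigma_algebraType (@open 'rV[R]_N).

Section Dynamics.
Context {R : realType} {N : nat}.
Implicit Types (M : set 'rV[R]_N) (F : 'rV[R]_N -> 'rV[R]_N).
Implicit Types (phi : R -> 'rV[R]_N -> 'rV[R]_N) (P : probability (phase R N) R).

(* phi t x0 = x(t, x0).  Only the values for t >= 0 and x0 in M matter; phi is
   extended measurably (e.g. by phi t x = x) to all (t, x). *)
Record is_flow M F phi : Prop := {
  flow_in : forall t x, 0 <= t -> M x -> M (phi t x) ;
  flow_0 : forall x, M x -> phi 0 x = x ;
  flow_D : forall s t x, 0 <= s -> 0 <= t -> M x ->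
    phi (s + t) x = phi s (phi t x) ;
  flow_ode : forall t x, 0 <= t -> M x ->
    (s - t)^-1 *: (phi s x - phi t x) @[s --> within [set s | 0 <= s] t^']
      --> F (phi t x) ;
  flow_measurable : measurable_fun [set: measurableTypeR R * phase R N]
    (fun z => phi z.1 z.2 : phase R N) }.

Definition equilibrium M phi P : Prop :=
  P M = 1%E /\
  forall t, 0 <= t -> forall A : set (phase R N), measurable A ->
    P (phi t @^-1` A) = P A.

Definition liouville_diff F (g : 'rV[R]_N -> R) (x : 'rV[R]_N) : R :=
  \sum_(k < N) F x 0 k * 'D_(delta_mx 0 k) g x.

(* The Liouville operator as a closed unbounded operator on L^2(P): the closure
   of sum_k F_k d/dx_k acting on smooth functions. *)
Definition liouville_graph P F (g h : phase R N -> R) : Prop :=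
  exists gn : nat -> phase R N -> R,
    [/\ forall n, smooth_on setT (gn n : 'rV[R]_N -> R),
        L2_cvg P \oo gn g &
        L2_cvg P \oo (fun n => liouville_diff F (gn n)) h].

Definition liouville_dom P F : set (phase R N -> R) :=
  [set g | exists h, liouville_graph P F g h].

Definition liouville P F (g : phase R N -> R) : phase R N -> R :=
  xget (cst 0) [set h | liouville_graph P F g h].

Definition QL P F (u0 g : phase R N -> R) : phase R N -> R :=
  mori_orth P u0 (liouville P F g).

Definition mz_Omega P F (u0 : phase R N -> R) : R :=
  inner P u0 (liouville P F u0) / inner P u0 u0.

Definition mz_K P F (u0 : phase R N -> R) (f : R -> phase R N -> R) (t : R) : R :=
  inner P u0 (liouville P F (f t)) / inner P u0 u0.

End Dynamics.

(* Main.v *)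
(* Let S_n be the orthogonal projection of L^2(P) onto the span of the first n
   modes xi_k, and T_n v = (I - S_n)(v - <v>).  The observables v with
   |T_n v| -> 0 form a closed subspace containing every u(t), by the
   Karhunen-Loeve expansion.  It therefore contains the L^2 derivative du/dt,
   and also the memory integral J(t): Fubini and Cauchy-Schwarz give Minkowski's
   inequality |T_n J(t)| <= int_0^t |K(t - s)| |T_n u(s)| ds, whose right-hand
   side tends to 0 by dominated convergence because |u(s)| is constant at
   equilibrium.  The Mori-Zwanzig equation then puts f(t) in this subspace, and
   the modes are forced to be h_k(t) = <f(t) - <f(t)>, xi_k> / sqrt(lam_k). *)

Require Import Defs.
From HB Require Import structures.
From mathcomp Require Import all_boot all_order all_algebra.
From mathcomp Require Import all_classical all_reals all_analysis.
From mathcomp Require Import measurable_realfun ring lra.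

Set Implicit Arguments.
Unset Strict Implicit.
Unset Printing Implicit Defensive.

Import Order.TTheory GRing.Theory Num.Theory.
Import numFieldNormedType.Exports.

Local Open Scope classical_set_scope.
Local Open Scope ring_scope.

(** * The semi-inner product and seminorm on square-integrable functions *)

Section InnerProduct.
Context {d : measure_display} {X : measurableType d} {R : realType}.
Variable P : probability X R.
Implicit Types (a c : R) (f g h : X -> R).

Local Notation L2 := (L2 P).
Local Notation inner := (inner P).
Local Notation mean := (mean P).

(** A real-valued seminorm on representatives, so that estimates stay in the field; [L2_normE]
    identifies it with the extended-real [L2_norm] on L2. *)
Definition nrm f : R := Num.sqrt (inner f f).

Lemma L2_measurable f : L2 f -> measurable_fun setT f.
Proof. by rewrite /Defs.L2 inE => /andP[/[!inE]]. Qed.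

Lemma L2P a f g : L2 f -> L2 g -> L2 (a *: f + g).
Proof. exact: (Lfun_submod_closed P (lee1n 2)).2. Qed.

Lemma L2_cst c : L2 (cst c).
Proof. exact: Lfun_cst. Qed.

Lemma L2_0 : L2 0.
Proof. exact: L2_cst. Qed.

Lemma L2Z a f : L2 f -> L2 (a *: f).
Proof. by move=> Lf; rewrite -[_ *: _]addr0; apply: L2P => //; exact: L2_0. Qed.

Lemma L2D f g : L2 f -> L2 g -> L2 (f + g).
Proof. by move=> Lf Lg; rewrite -[f]scale1r; exact: L2P. Qed.

Lemma L2B f g : L2 f -> L2 g -> L2 (f - g).
Proof. by move=> Lf Lg; rewrite -[- g]scaleN1r addrC; exact: L2P. Qed.

Lemma L2_sum n (J : pred nat) (v : nat -> X -> R) : (forall k, J k -> L2 (v k)) ->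
  L2 (\sum_(k < n | J k) v k).
Proof.
move=> Lv; elim/big_ind : _ => [||i Ji]; [exact: L2_0|exact: L2D|exact: Lv].
Qed.

Lemma L2_integrableM f g : L2 f -> L2 g -> P.-integrable setT (EFin \o (f \* g)).
Proof. by move=> Lf Lg; apply/Lfun1_integrable; exact: Lfun2_mul_Lfun1. Qed.

Lemma L2_integrable f : L2 f -> P.-integrable setT (EFin \o f).
Proof.
move=> /L2_integrableM /(_ (L2_cst 1)); congr (P.-integrable setT (EFin \o _)).
by apply/funext => x /=; rewrite mulr1.
Qed.

Lemma innerC f g : inner f g = inner g f.
Proof. by apply: eq_Rintegral => x _; rewrite mulrC. Qed.

Lemma innerPl a f g h : L2 f -> L2 g -> L2 h ->
  inner (a *: f + g) h = a * inner f h + inner g h.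
Proof.
move=> Lf Lg Lh; rewrite /Defs.inner -RintegralZl ?L2_integrableM//.
rewrite -RintegralD//; last exact: L2_integrableM.
  by apply: eq_Rintegral => x _ /=; rewrite mulrDl mulrA.
rewrite (_ : EFin \o _ = EFin \o (f \* (a *: h))).
  by apply: L2_integrableM => //; exact: L2Z.
by apply/funext => x /=; congr EFin; rewrite mulrCA.
Qed.

Lemma innerDl f g h : L2 f -> L2 g -> L2 h -> inner (f + g) h = inner f h + inner g h.
Proof. by move=> Lf Lg Lh; rewrite -[f in LHS]scale1r innerPl// mul1r. Qed.

Lemma inner0l h : inner 0 h = 0.
Proof.
rewrite /Defs.inner (@eq_Rintegral _ _ _ _ _ (cst 0)) ?Rintegral_cst ?mul0r// => x _.
by rewrite mul0r.
Qed.

Lemma innerZl a f h : L2 f -> L2 h -> inner (a *: f) h = a * inner f h.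
Proof.
move=> Lf Lh; rewrite -[a *: f in LHS]addr0 innerPl//; last exact: L2_0.
by rewrite inner0l addr0.
Qed.

Lemma innerBl f g h : L2 f -> L2 g -> L2 h -> inner (f - g) h = inner f h - inner g h.
Proof.
by move=> Lf Lg Lh; rewrite -[- g in LHS]scaleN1r addrC innerPl// mulN1r addrC.
Qed.

Lemma innerDr f g h : L2 f -> L2 g -> L2 h -> inner h (f + g) = inner h f + inner h g.
Proof. by move=> *; rewrite !(innerC h) innerDl. Qed.

Lemma innerZr a f h : L2 f -> L2 h -> inner h (a *: f) = a * inner h f.
Proof. by move=> *; rewrite !(innerC h) innerZl. Qed.

Lemma innerBr f g h : L2 f -> L2 g -> L2 h -> inner h (f - g) = inner h f - inner h g.
Proof. by move=> *; rewrite !(innerC h) innerBl. Qed.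

Lemma inner_suml n (J : pred nat) (v : nat -> X -> R) h :
  (forall k, J k -> L2 (v k)) -> L2 h ->
  inner (\sum_(k < n | J k) v k) h = \sum_(k < n | J k) inner (v k) h.
Proof.
(* Additivity of [inner] holds only for L2 arguments, so the induction carries membership in L2
   along with the value. *)
move=> Lv Lh; pose K f r := L2 f /\ inner f h = r.
suff [] : K (\sum_(k < n | J k) v k) (\sum_(k < n | J k) inner (v k) h) by [].
apply: big_ind2 => [|f1 r1 f2 r2 [L1 e1] [L2' e2]|k Jk]; split.
- exact: L2_0.
- exact: inner0l.
- exact: L2D.
- by rewrite innerDl// e1 e2.
- exact: Lv.
- by [].
Qed.

Lemma mean_inner f : mean f = inner f (cst 1).
Proof. by apply: eq_Rintegral => x _; rewrite mulr1. Qed.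

Lemma inner_cst1 : inner (cst 1) (cst 1) = 1.
Proof.
rewrite /Defs.inner (@eq_Rintegral _ _ _ _ _ (cst 1)) => [|x _]; last by rewrite mulr1.
by rewrite Rintegral_cst// mul1r; exact: (congr1 fine (probability_setT P)).
Qed.

Lemma inner_ge0 f : 0 <= inner f f.
Proof. by apply: Rintegral_ge0 => x _; rewrite -expr2 sqr_ge0. Qed.

Lemma nrm_ge0 f : 0 <= nrm f.
Proof. exact: sqrtr_ge0. Qed.

Lemma sqr_nrm f : nrm f ^+ 2 = inner f f.
Proof. by rewrite sqr_sqrtr ?inner_ge0. Qed.

Lemma nrm0 : nrm 0 = 0.
Proof. by rewrite /nrm inner0l sqrtr0. Qed.

Lemma nrmZ a f : L2 f -> nrm (a *: f) = `|a| * nrm f.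
Proof.
move=> Lf; rewrite /nrm innerZl// ?innerZr//; last exact: L2Z.
by rewrite mulrA -expr2 sqrtrM ?sqr_ge0// sqrtr_sqr.
Qed.

Lemma nrmN f : L2 f -> nrm (- f) = nrm f.
Proof. by move=> Lf; rewrite -scaleN1r nrmZ// normrN1 mul1r. Qed.

Lemma inner_sqr_le f g : L2 f -> L2 g -> inner f g ^+ 2 <= inner f f * inner g g.
Proof.
have inner_sqrB a c v w : L2 v -> L2 w -> inner (a *: v - c *: w) (a *: v - c *: w) =
    a ^+ 2 * inner v v - a * c * inner v w *+ 2 + c ^+ 2 * inner w w.
  move=> Lv Lw; have Lav := L2Z a Lv; have Lcw := L2Z c Lw.
  rewrite innerBl ?innerBr//; last exact: L2B.
  rewrite !innerZl ?innerZr// (innerC w v); ring.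
have main v w : L2 v -> L2 w -> 0 < inner w w ->
    inner v w ^+ 2 <= inner v v * inner w w.
  (* This vector is <w, w> times the component of v orthogonal to w, which avoids a division. *)
  move=> Lv Lw w0; have := inner_ge0 (inner w w *: v - inner v w *: w).
  rewrite inner_sqrB//.
  have -> : inner w w ^+ 2 * inner v v - inner w w * inner v w * inner v w *+ 2 +
      inner v w ^+ 2 * inner w w =
      inner w w * (inner v v * inner w w - inner v w ^+ 2) by ring.
  by rewrite pmulr_rge0// subr_ge0.
move=> Lf Lg.
have [g0|g0] := ltP 0 (inner g g); first exact: main.
have [f0|f0] := ltP 0 (inner f f); first by rewrite innerC mulrC; exact: main.
have {}g0 : inner g g = 0 by apply/le_anti; rewrite g0 inner_ge0.
have {}f0 : inner f f = 0 by apply/le_anti; rewrite f0 inner_ge0.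
(* A null function need not be 0 here. When both squared norms vanish, positivity at f - g and at f
   + g bounds <f, g> from both sides by 0. *)
have := inner_ge0 (1 *: f - 1 *: g); have := inner_ge0 (1 *: f - (-1) *: g).
rewrite !inner_sqrB// f0 g0 => ? ?.
by have -> : inner f g = 0 by lra; rewrite expr0n mulr0.
Qed.

Lemma inner_le f g : L2 f -> L2 g -> `|inner f g| <= nrm f * nrm g.
Proof.
move=> Lf Lg; rewrite -sqrtrM ?inner_ge0// -sqrtr_sqr ler_sqrt ?inner_sqr_le//.
by rewrite mulr_ge0 ?inner_ge0.
Qed.

Lemma nrmD f g : L2 f -> L2 g -> nrm (f + g) <= nrm f + nrm g.
Proof.
move=> Lf Lg; rewrite -ler_sqr ?nnegrE ?addr_ge0 ?nrm_ge0// sqr_nrm.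
have Lfg := L2D Lf Lg.
rewrite innerDl ?innerDr// (innerC g f) sqrrD !sqr_nrm.
have := le_trans (ler_norm _) (inner_le Lf Lg); lra.
Qed.

Lemma L2_normE f : L2 f -> L2_norm P f = (nrm f)%:E.
Proof.
move=> Lf; rewrite /L2_norm unlock /Lnorm.
have -> : (\int[P]_x (`|(EFin \o f) x| `^ 2) = (inner f f)%:E)%E.
  rewrite /Defs.inner /Rintegral fineK; last first.
    by apply: integrable_fin_num => //; exact: L2_integrableM.
  apply: eq_integral => x _ /=.
  by rewrite -expr2 powR_mulrn ?normr_ge0// real_normK ?num_real.
by rewrite poweR_EFin /nrm powR12_sqrt ?inner_ge0.
Qed.

Lemma L2_cvgP I (G : set_system I) (v : I -> X -> R) f : Filter G ->
  L2_cvg P G v f <->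
  [/\ L2 f, \forall i \near G, L2 (v i) & nrm (v i - f) @[i --> G] --> 0].
Proof.
move=> FG; split=> -[Lf Lv vf]; split=> //.
  apply: (@cvg_trans _ (fine (L2_norm P (v i - f)) @[i --> G])).
    apply: near_eq_cvg; near=> i => /=.
    by rewrite L2_normE//; apply: L2B => //; near: i.
  by move/fine_cvgP : vf => [].
apply: (@cvg_trans _ ((nrm (v i - f))%:E @[i --> G])).
  apply: near_eq_cvg; near=> i => /=.
  by rewrite [RHS]L2_normE//; apply: L2B => //; near: i.
by apply/fine_cvgP; split=> [|//]; exact: nearW.
Unshelve. all: end_near. Qed.

End InnerProduct.

Lemma ge0_cvg0P {R : realType} {I : Type} (G : set_system I) (f : I -> R) : Filter G ->
  (forall i, 0 <= f i) ->
  f i @[i --> G] --> 0 <-> (forall eps, 0 < eps -> \forall i \near G, f i <= eps).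
Proof.
move=> FG f0; split=> [/cvgrPdist_le cvgf eps eps0|lef].
  by have := cvgf _ eps0; apply: filterS => i /=; rewrite sub0r normrN ger0_norm.
apply/cvgrPdist_le => eps eps0.
by have := lef _ eps0; apply: filterS => i /=; rewrite sub0r normrN ger0_norm.
Qed.

(** * Centering, projection onto the first modes, and the closed subspace of expandable
    observables *)

Section OrthonormalSystem.
Context {d : measure_display} {X : measurableType d} {R : realType}.
Variable P : probability X R.
Variables (J : pred nat) (xi : nat -> X -> R).
Hypothesis xi_L2 : forall k, J k -> L2 P (xi k).
Hypothesis xi_orthonormal :
  forall i j, J i -> J j -> inner P (xi i) (xi j) = (i == j)%:R.
Implicit Types (a : R) (v w : X -> R) (n : nat).
#[local] Hint Extern 0 (L2 _ (xi _)) => solve [apply: xi_L2; assumption] : core.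

Definition fluct v : X -> R := v - cst (mean P v).

Definition proj n v : X -> R := \sum_(k < n | J k) inner P v (xi k) *: xi k.

Definition residual n v : X -> R := fluct v - proj n (fluct v).

(** For v in L2, this puts the centered observable in the closed span of the modes; no coefficients
    have to be named. *)
Definition expands v : Prop := nrm P (residual n v) @[n --> \oo] --> 0.

Lemma L2_fluct v : L2 P v -> L2 P (fluct v).
Proof. by move=> Lv; apply: L2B => //; exact: L2_cst. Qed.

Lemma L2_proj n v : L2 P (proj n v).
Proof.
apply: (@L2_sum _ _ _ P n J (fun k => inner P v (xi k) *: xi k)) => k Jk.
exact/L2Z/xi_L2.
Qed.

Lemma L2_residual n v : L2 P v -> L2 P (residual n v).
Proof. by move=> Lv; apply: L2B; [exact: L2_fluct|exact: L2_proj]. Qed.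

Lemma meanP a v w : L2 P v -> L2 P w -> mean P (a *: v + w) = a * mean P v + mean P w.
Proof. by move=> *; rewrite !mean_inner innerPl//; exact: L2_cst. Qed.

Lemma fluctP a v w : L2 P v -> L2 P w -> fluct (a *: v + w) = a *: fluct v + fluct w.
Proof.
move=> Lv Lw; apply/funext => x; rewrite /fluct meanP//.
change (a * v x + w x - (a * mean P v + mean P w) =
  a * (v x - mean P v) + (w x - mean P w)); ring.
Qed.

Lemma projP n a v w : L2 P v -> L2 P w -> proj n (a *: v + w) = a *: proj n v + proj n w.
Proof.
move=> Lv Lw; rewrite /proj scaler_sumr -big_split/=; apply: eq_bigr => k Jk.
by rewrite innerPl// scalerDl scalerA.
Qed.

Lemma residualP n a v w : L2 P v -> L2 P w ->
  residual n (a *: v + w) = a *: residual n v + residual n w.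
Proof.
move=> Lv Lw; rewrite /residual fluctP// projP//; try exact: L2_fluct.
by rewrite (scalerBr a (fluct v)) opprD addrACA.
Qed.

Lemma residualB n v w : L2 P v -> L2 P w ->
  residual n (v - w) = residual n v - residual n w.
Proof.
by move=> *; rewrite addrC -scaleN1r residualP// scaleN1r addrC.
Qed.

(** Both sides equal <v, w> - <v><w>: centering removes the component along the constants, which is
    a self-adjoint operation. *)
Lemma inner_fluct v w : L2 P v -> L2 P w ->
  inner P (fluct v) w = inner P v (fluct w).
Proof.
move=> Lv Lw; have L1 := L2_cst P 1.
have cstE c : cst c = c *: cst 1 :> (X -> R).
  by apply/funext => x; exact: (esym (mulr1 _)).
rewrite /fluct innerBl ?innerBr//; try exact: L2_cst.
rewrite cstE (cstE (mean P w)) innerZl// innerZr// mean_inner mean_inner.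
by rewrite (innerC _ (cst 1) w) mulrC.
Qed.

Lemma inner_projE n v h : L2 P h ->
  inner P (proj n v) h = \sum_(k < n | J k) inner P v (xi k) * inner P (xi k) h.
Proof.
move=> Lh; rewrite (inner_suml _ (v := fun k => inner P v (xi k) *: xi k))//.
  by apply: eq_bigr => k Jk; rewrite innerZl.
by move=> k Jk; exact/L2Z/xi_L2.
Qed.

Lemma inner_proj_xi n v k : J k -> (k < n)%N ->
  inner P (proj n v) (xi k) = inner P v (xi k).
Proof.
move=> Jk kn; rewrite inner_projE//.
rewrite (bigD1 (Ordinal kn))//= xi_orthonormal// eqxx mulr1.
rewrite big1 ?addr0// => i /andP[Ji ik].
by rewrite xi_orthonormal// (_ : (_ == k) = false) ?mulr0//; exact: negbTE.
Qed.

Lemma inner_proj n v w : L2 P v -> L2 P w ->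
  inner P (proj n v) w = inner P v (proj n w).
Proof.
move=> Lv Lw; rewrite (innerC P v) !inner_projE//; apply: eq_bigr => k Jk.
by rewrite (innerC P w) (innerC P (xi k) v) mulrC.
Qed.

Lemma proj_id n v : proj n (proj n v) = proj n v.
Proof. by apply: eq_bigr => k Jk; rewrite inner_proj_xi. Qed.

(** Pythagoras, from [proj n] being self-adjoint and idempotent. It yields both the contraction
    bound [nrm_residual_le] and the measurability in time of residual norms. *)
Lemma sqr_nrm_subproj n v : L2 P v ->
  nrm P (v - proj n v) ^+ 2 = inner P v v - \sum_(k < n | J k) inner P v (xi k) ^+ 2.
Proof.
move=> Lv; have Lp := L2_proj n v.
have sE : inner P (proj n v) v = \sum_(k < n | J k) inner P v (xi k) ^+ 2.
  rewrite inner_projE//; apply: eq_bigr => k Jk.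
  by rewrite (innerC P (xi k)) expr2.
rewrite sqr_nrm innerBl ?innerBr//; last exact: L2B.
by rewrite (inner_proj n Lv Lp) proj_id (innerC P v (proj n v)) sE subrr subr0.
Qed.

Lemma sqr_nrm_fluct v : L2 P v ->
  nrm P (fluct v) ^+ 2 = inner P v v - mean P v ^+ 2.
Proof.
move=> Lv; have Lc := L2_fluct Lv; have L1 := L2_cst P 1.
(* Centering is idempotent because the constant 1 has unit norm under a probability measure. *)
have cc : fluct (fluct v) = fluct v.
  rewrite {1}/fluct (_ : mean P (fluct v) = 0) ?subr0// mean_inner inner_fluct//.
  by rewrite /fluct mean_inner inner_cst1 subrr innerC inner0l.
rewrite sqr_nrm inner_fluct// cc {1}/fluct innerBr//; last exact: L2_cst.
rewrite (_ : cst (mean P v) = mean P v *: cst 1 :> (X -> R)).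
  by rewrite innerZr// -mean_inner expr2.
by apply/funext => x; exact: (esym (mulr1 _)).
Qed.

(** Centering and projecting each only subtract squares from the squared norm. Uniformity in n is
    what makes the subspace closed and supplies the dominating function later. *)
Lemma nrm_residual_le n v : L2 P v -> nrm P (residual n v) <= nrm P v.
Proof.
move=> Lv; have Lc := L2_fluct Lv.
rewrite -ler_sqr ?nnegrE ?nrm_ge0// sqr_nrm_subproj// -sqr_nrm.
rewrite sqr_nrm_fluct// (sqr_nrm P v).
have : 0 <= \sum_(k < n | J k) inner P (fluct v) (xi k) ^+ 2.
  by apply: sumr_ge0 => k _; exact: sqr_ge0.
have := sqr_ge0 (mean P v); lra.
Qed.

(** The adjoint of [residual n]. Its two self-adjoint factors appear in reverse order, since they
    need not commute when the modes are not centered. *)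
Definition residual_adj n w : X -> R := fluct (w - proj n w).

Lemma L2_residual_adj n w : L2 P w -> L2 P (residual_adj n w).
Proof. by move=> Lw; apply/L2_fluct/L2B => //; exact: L2_proj. Qed.

Lemma inner_residual n v w : L2 P v -> L2 P w ->
  inner P (residual n v) w = inner P v (residual_adj n w).
Proof.
move=> Lv Lw; have Lc := L2_fluct Lv; have Lp w' := L2_proj n w'.
rewrite -inner_fluct//; last exact: L2B.
by rewrite innerBl// innerBr// inner_proj.
Qed.

Lemma expandsP a v w : L2 P v -> L2 P w -> expands v -> expands w ->
  expands (a *: v + w).
Proof.
move=> Lv Lw Ev Ew; rewrite /expands.
have lim0 : `|a| * nrm P (residual n v) + nrm P (residual n w) @[n --> \oo]
    --> `|a| * 0 + 0.
  by apply: cvgD Ew; apply: cvgM Ev; exact: cvg_cst.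
rewrite mulr0 addr0 in lim0.
apply: (squeeze_cvgr _ (cvg_cst 0) lim0); near=> n.
rewrite nrm_ge0/= residualP//; have Lrv := L2_residual n Lv.
by rewrite -(nrmZ a Lrv) (nrmD (L2Z a Lrv) (L2_residual n Lw)).
Unshelve. all: by end_near. Qed.

Lemma expands0 : expands 0.
Proof.
rewrite /expands (_ : (fun n => _) = cst 0); first exact: cvg_cst.
apply/funext => n; apply/le_anti; rewrite nrm_ge0 andbT -(nrm0 P).
by apply: nrm_residual_le; exact: L2_0.
Qed.

Lemma expandsZ a v : L2 P v -> expands v -> expands (a *: v).
Proof.
move=> Lv Ev; rewrite -[a *: v]addr0.
exact: (expandsP _ Lv (L2_0 P) Ev expands0).
Qed.

Lemma expandsB v w : L2 P v -> L2 P w -> expands v -> expands w -> expands (v - w).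
Proof.
by move=> Lv Lw Ev Ew; rewrite addrC -scaleN1r; exact: (expandsP _ Lw Lv Ew Ev).
Qed.

(** Properness of G provides a single index i with v i expandable and within eps / 2 of w. The
    residual of w is that of v i minus that of v i - w; the first is eventually at most eps / 2, the
    second is so for every n by contraction. *)
Lemma expands_closed I (G : set_system I) (v : I -> X -> R) w : ProperFilter G ->
  L2_cvg P G v w -> (\forall i \near G, expands (v i)) -> expands w.
Proof.
move=> FG /L2_cvgP[Lw Lv /ge0_cvg0P vw] Ev.
apply/ge0_cvg0P => [n|eps eps0]; first exact: nrm_ge0.
have eps2 : 0 < eps / 2 by rewrite divr_gt0.
have vw2 := vw (fun=> nrm_ge0 _ _) _ eps2.
have [i [[Lvi Evi] vwi]] : exists i, (L2 P (v i) /\ expands (v i)) /\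
    nrm P (v i - w) <= eps / 2.
  by apply: (@filter_ex _ G); apply: filterI => //; exact: filterI.
move/ge0_cvg0P : Evi => /(_ (fun=> nrm_ge0 _ _) _ eps2); apply: filterS => n Evn.
have Lvw := L2B Lvi Lw; have Lrvw := L2_residual n Lvw.
rewrite -[w](subKr (v i)) residualB// (splitr eps).
apply: le_trans (nrmD (L2_residual n Lvi) _) _.
  by rewrite -scaleN1r; exact: L2Z.
rewrite (nrmN Lrvw); apply: lerD Evn _.
exact: le_trans (nrm_residual_le n Lvw) vwi.
Qed.

End OrthonormalSystem.

(** * Minkowski's inequality for pointwise time integrals *)

Section VectorIntegral.
Context {d : measure_display} {X : measurableType d} {R : realType}.
Variable P : probability X R.
Variables (k : R -> R) (U : R -> X -> R) (B : R).
Local Notation mu := (@lebesgue_measure R).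
Hypothesis k_integrable : mu.-integrable setT (EFin \o k).
Hypothesis U_measurable : measurable_fun [set: measurableTypeR R * X] (fun z => U z.1 z.2).
Hypothesis U_L2 : forall s, L2 P (U s).
Hypothesis U_le : forall s, nrm P (U s) <= B.

Definition vint (x : X) : R := \int[mu]_s (k s * U s x).

Lemma k_measurable : measurable_fun setT k.
Proof. by apply/measurable_EFinP; exact: measurable_int k_integrable. Qed.

(** The hypothesis of Fubini's theorem. From |U g| <= U^2 + g^2, integrating over X at time s gives
    at most |k s| (B^2 + <g, g>), which is integrable in s. *)
Lemma integrable_prod (g : X -> R) : L2 P g ->
  (mu \x P)%E.-integrable setT (fun z => (k z.1 * (U z.1 z.2 * g z.2))%:E).
Proof.
move=> Lg; have mg := L2_measurable Lg.
have mkUg : measurable_fun [set: measurableTypeR R * X]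
    (fun z => k z.1 * (U z.1 z.2 * g z.2)).
  apply: measurable_funM; first exact: (measurableT_comp k_measurable).
  by apply: measurable_funM => //; exact: (measurableT_comp mg).
apply/integrable12ltyP => /=; first exact/measurable_EFinP.
pose C := B ^+ 2 + inner P g g.
have Uge s : (\int[P]_x `|(k s * (U s x * g x))%:E| <= `|(k s * C)%:E|)%E.
  have iUg : P.-integrable setT (EFin \o (U s \* U s \+ g \* g)).
    exact: (integrableD measurableT (L2_integrableM (U_L2 s) (U_L2 s)) (L2_integrableM Lg Lg)).
  have ikUg : P.-integrable setT (EFin \o (fun x => `|k s| * (U s x * U s x + g x * g x))).
    exact: (integrableZl measurableT _ iUg).
  have C0 : 0 <= C by rewrite addr_ge0 ?sqr_ge0 ?inner_ge0.
  apply: (@le_trans _ _ (\int[P]_x (`|k s| * (U s x * U s x + g x * g x))%:E)%E).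
    apply: ge0_le_integral => //.
    - apply: measurableT_comp => //; apply/measurable_EFinP.
      apply: measurable_funM => //; apply: measurable_funM => //.
      exact: L2_measurable.
    - exact: measurable_int ikUg.
    - move=> x _; rewrite lee_fin normrM ler_wpM2l// -!expr2.
      rewrite ler_norml; have := sqr_ge0 (U s x - g x); have := sqr_ge0 (U s x + g x).
      have := sqr_ge0 (U s x); have := sqr_ge0 (g x).
      by rewrite sqrrB sqrrD => ? ? ? ?; apply/andP; split; lra.
  rewrite -[leLHS]fineK; last exact: integrable_fin_num.
  rewrite -/(Rintegral _ _ _) RintegralZl// RintegralD//; try exact: L2_integrableM.
  rewrite -/(inner P (U s) (U s)) -/(inner P g g) lee_fin normrM (ger0_norm C0).
  rewrite ler_wpM2l// lerD2r -sqr_nrm ler_sqr ?nnegrE ?nrm_ge0//.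
  exact: le_trans (nrm_ge0 _ _) (U_le s).
have ikC : mu.-integrable setT (fun s => (k s * C)%:E).
  by have := integrableZr measurableT C k_integrable.
apply: le_lt_trans (integrableP _ _ _ ikC).2.
apply: ge0_le_integral => //.
- by move=> s _; exact: integral_ge0.
- apply: (@measurable_fun_fubini_tonelli_F _ _ _ _ _ P
    (fun z : measurableTypeR R * X => `|(k z.1 * (U z.1 z.2 * g z.2))%:E|%E)) => //.
  by apply: measurableT_comp => //; exact/measurable_EFinP.
- by apply: measurableT_comp => //; exact: measurable_int ikC.
- by move=> s _; exact: Uge.
Qed.

(** The integral taken pointwise on X is also a weak integral in L2, by Fubini. *)
Lemma inner_vint (g : X -> R) : L2 P vint -> L2 P g ->
  mu.-integrable setT (fun s => (k s * inner P (U s) g)%:E) /\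
  inner P vint g = \int[mu]_s (k s * inner P (U s) g).
Proof.
move=> Lv Lg; have ikUg := integrable_prod Lg.
(* Taking g = 1 makes [k s * U s x] integrable in s for almost every x, which allows the factor g x
   to be moved across the time integral. *)
have ikU1 := integrable_prod (L2_cst P 1).
have FE s : (\int[P]_x (k s * (U s x * g x))%:E = (k s * inner P (U s) g)%:E)%E.
  rewrite -RintegralZl//; last exact: L2_integrableM.
  rewrite fineK//; apply: integrable_fin_num => //.
  exact: (integrableZl measurableT _ (L2_integrableM (U_L2 s) Lg)).
split.
  by have := integrable_fubini_F ikUg; rewrite /fubini_F; under eq_fun do rewrite FE.
rewrite /inner [in LHS]/Rintegral [RHS]/Rintegral; congr fine.
under [RHS]eq_integral do rewrite -FE.
rewrite (Fubini ikUg); apply: ae_eq_integral => //.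
- exact: measurable_int (L2_integrableM Lv Lg).
- exact: measurable_fubini_G ikUg.
apply: filterS (ae_integrable2 ikU1) => x /= ikU _.
have ikU' : mu.-integrable setT (EFin \o (fun s => k s * U s x)).
  by move: ikU; under eq_fun do rewrite mulr1.
rewrite mulrC /vint -RintegralZl// fineK.
  by apply: eq_integral => s _; rewrite mulrCA [g x * _]mulrC.
by apply: integrable_fin_num => //; exact: (integrableZl measurableT _ ikU').
Qed.

(** Duality: |T v|^2 = <v, T' T v> is a weak integral of k(s) <U s, T' T v>, that is, of k(s) <T (U
    s), T v>, and Cauchy-Schwarz bounds it by |T v| times the right-hand side. The adjoint makes it
    unnecessary to commute T with the integral. *)
Lemma nrm_vint_le (T T' : (X -> R) -> X -> R) :
  (forall v, L2 P v -> L2 P (T v)) -> (forall v, L2 P v -> L2 P (T' v)) ->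
  (forall v w, L2 P v -> L2 P w -> inner P (T v) w = inner P v (T' w)) ->
  (forall v, L2 P v -> nrm P (T v) <= nrm P v) ->
  measurable_fun setT (fun s => nrm P (T (U s))) ->
  L2 P vint -> nrm P (T vint) <= \int[mu]_s (`|k s| * nrm P (T (U s))).
Proof.
move=> LT LT' adjT leT mT Lv; have LTv := LT _ Lv.
have iNT : mu.-integrable setT (EFin \o (fun s => `|k s| * nrm P (T (U s)))).
  have ikB : mu.-integrable setT (fun s => (k s * B)%:E).
    by have := integrableZr measurableT B k_integrable.
  apply: le_integrable ikB => //.
    apply/measurable_EFinP; apply: measurable_funM => //.
    by apply: measurableT_comp => //; exact: k_measurable.
  move=> s _; rewrite lee_fin !normrM normr_id ler_wpM2l//.
  rewrite (ger0_norm (nrm_ge0 _ _)); apply: le_trans (leT _ (U_L2 s)) _.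
  exact: le_trans (U_le s) (ler_norm _).
(* The factor |T v| is to be cancelled, so its vanishing is treated apart. *)
have [|Tv0] := eqVneq (nrm P (T vint)) 0.
  by move=> ->; apply: Rintegral_ge0 => s _; rewrite mulr_ge0 ?nrm_ge0.
have {}Tv0 : 0 < nrm P (T vint) by rewrite lt0r Tv0 nrm_ge0.
rewrite -(ler_pM2r Tv0) -expr2 sqr_nrm adjT//.
have [ik ->] := inner_vint Lv (LT' _ LTv).
rewrite -RintegralZr//; apply: le_Rintegral => //.
  exact: (integrableZr measurableT _ iNT).
move=> s _; rewrite -adjT// -mulrA.
apply: le_trans (ler_norm _) _; rewrite normrM ler_wpM2l//.
by apply: inner_le => //; exact: LT.
Qed.

End VectorIntegral.

(** * Invariance of Lebesgue measure under s -> t - s, for the convolution kernel K(t - s) *)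

Lemma lebesgue_measure_refl {R : realType} (t : R) (A : set R) : measurable A ->
  pushforward lebesgue_measure (fun s => t - s : measurableTypeR R) A =
  lebesgue_measure A.
Proof.
have mt : measurable_fun [set: measurableTypeR R] (fun s => t - s : measurableTypeR R).
  by apply: measurable_funB; [exact: measurable_cst|exact: measurable_id].
pose mtM := isMeasurableFun.Build _ _ _ _ _ mt.
pose mtP : {mfun measurableTypeR R >-> measurableTypeR R} :=
  HB.pack (fun s => t - s : measurableTypeR R) mtM.
(* By uniqueness it suffices to compare the measures on intervals ]a, b], whose preimages [t - b, t
   - a[ have the same length. *)
move=> mA; apply/esym/(@lebesgue_measure_unique _
  (pushforward lebesgue_measure (mtP : _ -> measurableTypeR R))) => //= _ [[a b]] _ <-.
rewrite /pushforward (_ : _ @^-1` _ = `[t - b, t - a[%classic).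
  rewrite !lebesgue_measure_itv/= !lte_fin ltrD2l ltrN2 -!EFinB.
  by case: ifP => // _; congr EFin; ring.
by apply/seteqP; split=> s /=; rewrite !in_itv/= => /andP[? ?]; apply/andP; split; lra.
Qed.

Lemma integrable_refl {R : realType} (k : R -> R) (t : R) :
  lebesgue_measure.-integrable setT (EFin \o k) ->
  lebesgue_measure.-integrable setT (EFin \o (fun s => k (t - s))).
Proof.
move=> ik; have mk := measurable_int _ ik.
have mt : measurable_fun [set: measurableTypeR R] (fun s => t - s : measurableTypeR R).
  by apply: measurable_funB; [exact: measurable_cst|exact: measurable_id].
apply/integrableP; split; first exact: (measurableT_comp mk).
have /integrableP[_] := ik; congr (_ < _)%E.
pose refl : measurableTypeR R -> measurableTypeR R := fun s => t - s.
rewrite -[RHS](@ge0_integral_pushforward _ _ _ _ _ refl mt lebesgue_measure setT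
  (fun s : measurableTypeR R => `|(k s)%:E|%E))//.
  apply: eq_measure_integral => A mA _.
  exact: (esym (lebesgue_measure_refl t mA)).
exact: measurableT_comp.
Qed.

(** * Expandability of time integrals *)

Section ExpandsIntegral.
Context {d : measure_display} {X : measurableType d} {R : realType}.
Variable P : probability X R.
Variables (J : pred nat) (xi : nat -> X -> R).
Hypothesis xi_L2 : forall k, J k -> L2 P (xi k).
Hypothesis xi_orthonormal :
  forall i j, J i -> J j -> inner P (xi i) (xi j) = (i == j)%:R.
Variables (k : R -> R) (U : R -> X -> R) (B : R).
Local Notation mu := (@lebesgue_measure R).
Hypothesis k_integrable : mu.-integrable setT (EFin \o k).
Hypothesis U_measurable : measurable_fun [set: measurableTypeR R * X] (fun z => U z.1 z.2).
Hypothesis U_L2 : forall s, L2 P (U s).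
Hypothesis U_le : forall s, nrm P (U s) <= B.
Hypothesis U_residual :
  forall n, measurable_fun setT (fun s => nrm P (residual P J xi n (U s))).
Hypothesis U_expands : forall s, expands P J xi (U s).

(** Minkowski's inequality for the operator [residual n] bounds the residual of the integral by the
    integral of [r n]. This tends to 0 by dominated convergence: [r n s] tends to 0 for each s, and
    contraction bounds it by |k s| B. *)
Lemma expands_vint : L2 P (vint k U) -> expands P J xi (vint k U).
Proof.
move=> Lv; pose r n s := `|k s| * nrm P (residual P J xi n (U s)).
have r0 : \int[mu]_s r n s @[n --> \oo] --> 0.
  have mk : measurable_fun setT (fun s => `|k s|).
    exact: measurableT_comp (k_measurable k_integrable).
  have ikB : mu.-integrable setT (fun s => `|(k s * B)%:E|%E).
    by apply: integrable_abse; have := integrableZr measurableT B k_integrable.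
  have [||||_ _ rE] := @dominated_convergence _ _ _ mu setT measurableT
      (fun n s => (r n s)%:E) (cst 0%E) _ _ _ _ ikB.
  - move=> n; apply/measurable_EFinP; apply: measurable_funM; first exact: mk.
    exact: U_residual.
  - exact: measurable_cst.
  - apply: nearW => s _; apply: cvg_EFin; first exact: nearW.
    rewrite -[X in _ --> X](mulr0 `|k s|); apply: cvgM; first exact: cvg_cst.
    exact: U_expands.
  - apply: nearW => s n _; rewrite !abse_EFin lee_fin !normrM normr_id ler_wpM2l//.
    rewrite ger0_norm ?nrm_ge0//.
    apply: le_trans (nrm_residual_le xi_L2 xi_orthonormal n (U_L2 s)) _.
    exact: le_trans (U_le s) (ler_norm _).
  move: rE; rewrite integral0 => /fine_cvgP[_].
  exact.
apply: (squeeze_cvgr _ (cvg_cst 0) r0); apply: nearW => n.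
rewrite nrm_ge0/=; apply: (nrm_vint_le k_integrable U_measurable U_L2 U_le
  (T' := residual_adj P J xi n)) => //.
- by move=> v; exact: L2_residual.
- by move=> v; exact: L2_residual_adj.
- by move=> v w; exact: inner_residual.
- by move=> v; exact: nrm_residual_le.
Qed.

End ExpandsIntegral.

(** * Composition with a measure-preserving map *)

Section MeasurePreserving.
Context {d : measure_display} {X : measurableType d} {R : realType}.
Variable P : probability X R.
Variable phi : X -> X.
Hypothesis phi_measurable : measurable_fun setT phi.
Hypothesis phi_preserving : forall A, measurable A -> P (phi @^-1` A) = P A.

Lemma L2_comp (g : X -> R) : L2 P g -> L2 P (g \o phi).
Proof.
rewrite /L2 !inE => /andP[/[!inE]/= mg gfin]; apply/andP; split; rewrite inE/=.
  exact: measurableT_comp.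
suff E : (\int[P]_x (`|(EFin \o (g \o phi)) x| `^ 2) =
    \int[P]_x (`|(EFin \o g) x| `^ 2))%E.
  by move: gfin; rewrite /finite_norm unlock /Lnorm E.
rewrite -[LHS](ge0_integral_pushforward phi_measurable P measurableT
  (f := fun x => (`|(g x)%:E| `^ 2)%E)).
- by apply: eq_measure_integral => A mA _; rewrite -[RHS]phi_preserving.
- apply: (measurableT_comp (measurable_poweR _)) => //.
  by apply: measurableT_comp => //; exact/measurable_EFinP.
- by move=> x _; exact: poweR_ge0.
Qed.

Lemma Rintegral_comp (g : X -> R) : measurable_fun setT g ->
  P.-integrable setT (EFin \o (g \o phi)) -> \int[P]_x g (phi x) = \int[P]_x g x.
Proof.
move=> mg ig; rewrite /Rintegral; congr fine.
rewrite -[LHS](integral_pushforward phi_measurable (f := EFin \o g) _ ig measurableT).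
  by apply: eq_measure_integral => A mA _; rewrite -[RHS]phi_preserving.
exact/measurable_EFinP.
Qed.

Lemma mean_comp (g : X -> R) : L2 P g -> mean P (g \o phi) = mean P g.
Proof.
move=> Lg; apply: Rintegral_comp; first exact: L2_measurable Lg.
exact/L2_integrable/L2_comp.
Qed.

Lemma nrm_comp (g : X -> R) : L2 P g -> nrm P (g \o phi) = nrm P g.
Proof.
move=> Lg; congr Num.sqrt; apply: (@Rintegral_comp (g \* g)).
  by apply: measurable_funM; exact: L2_measurable Lg.
by apply: L2_integrableM; exact: L2_comp.
Qed.

End MeasurePreserving.

(** * Characterization of series expansions over a given orthonormal system *)

Section SeriesExpansion.
Context {d : measure_display} {X : measurableType d} {R : realType}.
Variable P : probability X R.
Variables (rk : option nat) (lam : nat -> R) (xi : nat -> X -> R).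
Local Notation J := (is_mode rk).
Hypothesis lam_gt0 : forall k, J k -> 0 < lam k.
Hypothesis xi_L2 : forall k, J k -> L2 P (xi k).
Hypothesis xi_orthonormal :
  forall i j, J i -> J j -> inner P (xi i) (xi j) = (i == j)%:R.

Let partial_sum (m : nat -> R) (g : X -> R) n (x : X) : R :=
  mean P g + \sum_(k < n | J k) Num.sqrt (lam k) * xi k x * m k.

Let partial_sumB m g n : (fun x => partial_sum m g n x - g x) =
  \sum_(k < n | J k) (Num.sqrt (lam k) * m k) *: xi k - fluct P g.
Proof.
apply/funext => x; rewrite /partial_sum.
have -> : \sum_(k < n | J k) Num.sqrt (lam k) * xi k x * m k =
    (\sum_(k < n | J k) (Num.sqrt (lam k) * m k) *: xi k) x.
  by rewrite fct_sumE; apply: eq_bigr => k _; rewrite mulrAC.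
move: (\sum_(k < n | J k) _) => S.
change (mean P g + S x - g x = S x - (g x - mean P g)); ring.
Qed.

Let L2_combination n (c : nat -> R) : L2 P (\sum_(k < n | J k) c k *: xi k).
Proof.
apply: (@L2_sum _ _ _ P n J (fun k => c k *: xi k)) => k Jk.
exact/L2Z/xi_L2.
Qed.

Let L2_partial_sum m g n : L2 P g -> L2 P (partial_sum m g n).
Proof.
move=> Lg; have -> : partial_sum m g n = (fun x => partial_sum m g n x - g x) + g.
  by apply/funext => x; exact: (esym (subrK _ _)).
rewrite partial_sumB; apply: L2D => //; apply: L2B; last exact: L2_fluct.
exact: (L2_combination n (fun k => Num.sqrt (lam k) * m k)).
Qed.

(** The right-hand side does not depend on n: once mode k has entered the partial sum, its
    coefficient in the error is frozen. This is the source of uniqueness. *)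
Let partial_sum_coef m g n k : L2 P g -> J k -> (k < n)%N ->
  inner P (fun x => partial_sum m g n x - g x) (xi k) =
  Num.sqrt (lam k) * m k - inner P (fluct P g) (xi k).
Proof.
move=> Lg Jk kn; have Lk := xi_L2 Jk; pose c i := Num.sqrt (lam i) * m i.
rewrite partial_sumB (innerBl (L2_combination n c) (L2_fluct Lg) Lk); congr (_ - _).
rewrite (inner_suml _ (v := fun i => c i *: xi i))//; last first.
  by move=> i Ji; exact/L2Z/xi_L2.
rewrite (bigD1 (Ordinal kn))//= (innerZl _ Lk Lk) xi_orthonormal// eqxx mulr1.
rewrite big1 ?addr0// => i /andP[Ji ik].
rewrite (innerZl _ (xi_L2 Ji) Lk) xi_orthonormal// (_ : (_ == k) = false) ?mulr0//.
exact: negbTE.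
Qed.

Lemma L2_cvg_partial_sum m g :
  L2_cvg P \oo (partial_sum m g) g <->
  [/\ L2 P g, expands P J xi g &
      forall k, J k -> m k = inner P (fluct P g) (xi k) / Num.sqrt (lam k)].
Proof.
have residualE : (forall k, J k -> m k = inner P (fluct P g) (xi k) / Num.sqrt (lam k)) ->
    L2 P g -> forall n, nrm P (fun x => partial_sum m g n x - g x) =
                        nrm P (residual P J xi n g).
  move=> mE Lg n; rewrite partial_sumB -[RHS](nrmN (L2_residual xi_L2 n Lg)).
  rewrite /residual (opprB (fluct P g)); congr (nrm P (_ - fluct P g)).
  apply: eq_bigr => k Jk; congr (_ *: _).
  by rewrite mE// mulrC divfK// gt_eqF// sqrtr_gt0 lam_gt0.
split=> [/L2_cvgP[Lg _ cvgS]|[Lg Eg mE]].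
  suff mE : forall k, J k -> m k = inner P (fluct P g) (xi k) / Num.sqrt (lam k).
    split=> //; rewrite /expands.
    by under eq_cvg do rewrite -residualE//.
  move=> k Jk; have lk : 0 < Num.sqrt (lam k) by rewrite sqrtr_gt0 lam_gt0.
  apply: (mulfI (lt0r_neq0 lk)); rewrite mulrCA divff ?gt_eqF// mulr1.
  apply/eqP; rewrite -subr_eq0 -normr_le0; apply/ler_addgt0Pr => eps eps0.
  move/ge0_cvg0P : cvgS => /(_ (fun=> nrm_ge0 _ _) _ eps0) cvgS.
  have [n [kn Sn]] : exists n, (k < n)%N /\
      nrm P (fun x => partial_sum m g n x - g x) <= eps.
    by apply: (@filter_ex _ \oo); apply: filterI cvgS; exact: nbhs_infty_gt.
  rewrite add0r -(partial_sum_coef m Lg Jk kn).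
  have LS : L2 P (fun x => partial_sum m g n x - g x).
    exact: L2B (L2_partial_sum m n Lg) Lg.
  apply: le_trans (inner_le LS (xi_L2 Jk)) _.
  by rewrite /nrm [X in _ * Num.sqrt X]xi_orthonormal// eqxx sqrtr1 mulr1.
apply/L2_cvgP; split=> //; first by apply: nearW => n; exact: L2_partial_sum.
by apply: cvg_trans Eg; apply: near_eq_cvg; apply: nearW => n; rewrite -residualE.
Qed.

End SeriesExpansion.

(** * Limits in time on [0, T] and clamped times *)

Lemma within_itv_dnbhs_proper {R : realType} (T t : R) : 0 < T -> t \in `[0, T] ->
  ProperFilter (within (`[0, T] : set R) t^').
Proof.
move=> T0; rewrite in_itv/= => /andP[t0 tT]; apply: Build_ProperFilter_ex => A.
rewrite /within/= => At.
(* Points of [0, T] other than t accumulate at t from the right when t < T, and from the left when t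
   = T, as 0 < T. Without this the limit defining the derivative would be vacuous. *)
have [tltT|Tlet] := ltP t T.
- have At' : \forall s \near t^'+, s \in `[0, T] -> A s.
    by apply: (@filterS _ (nbhs t)) At => s + ts; apply; rewrite gt_eqF.
  have [s [As [ts sT]]] : exists s, (s \in `[0, T] -> A s) /\ t < s /\ s < T.
    apply: (@filter_ex _ t^'+); apply: filterI At' _.
    by apply: filterI; [exact: nbhs_right_gt|exact: nbhs_right_lt].
  by exists s; apply: As; rewrite in_itv/= (ltW sT) (le_trans t0 (ltW ts)).
- have t_gt0 := lt_le_trans T0 Tlet.
  have At' : \forall s \near t^'-, s \in `[0, T] -> A s.
    by apply: (@filterS _ (nbhs t)) At => s + st; apply; rewrite lt_eqF.
  have [s [As [st s0]]] : exists s, (s \in `[0, T] -> A s) /\ s < t /\ 0 < s.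
    apply: (@filter_ex _ t^'-); apply: filterI At' _.
    by apply: filterI; [exact: nbhs_left_lt|exact: nbhs_left_gt].
  by exists s; apply: As; rewrite in_itv/= (ltW s0) (le_trans (ltW st) tT).
Qed.

(* Times are clamped to [0, T] because u(s) is controlled only for s >= 0 and
   the modes e_k are measurable only on [0, T]. *)
Definition clamp {R : realType} (T s : R) : R := Num.max 0 (Num.min s T).

Lemma clamp_itv {R : realType} (T s : R) : 0 <= T -> clamp T s \in `[0, T].
Proof.
by move=> T0; rewrite in_itv/= /clamp le_max lexx/= ge_max T0/= ge_min lexx orbT.
Qed.

Lemma clamp_id {R : realType} (T s : R) : s \in `[0, T] -> clamp T s = s.
Proof.
by rewrite in_itv/= /clamp => /andP[s0 sT]; rewrite min_l// max_r.
Qed.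

Lemma measurable_clamp {R : realType} (T : R) : measurable_fun setT (clamp T).
Proof.
apply: measurable_maxr; first exact: measurable_cst.
by apply: measurable_minr; [exact: measurable_id|exact: measurable_cst].
Qed.

Lemma L2_QL {R : realType} {N : nat} (P : probability (phase R N) R)
    (F : 'rV[R]_N -> 'rV[R]_N) (u0 g : phase R N -> R) :
  L2 P u0 -> liouville_dom P F g -> L2 P (QL P F u0 g).
Proof.
move=> Lu0 [h gh]; apply: L2B; last exact: L2Z.
(* On the domain, [xget] returns an actual element of the graph, hence an L2 limit, and not its
   default 0. *)
have [gn [_ _ []]] : liouville_graph P F g (liouville P F g).
  by apply: (xgetPex (cst 0)); exists h.
by [].
Qed.

(** * The observable along the flow and the terms of the Mori-Zwanzig equation *)

Section FlowOrbit.
Context {R : realType} {N : nat}.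
Variables (M : set 'rV[R]_N) (F : 'rV[R]_N -> 'rV[R]_N).
Variables (phi : R -> 'rV[R]_N -> 'rV[R]_N) (P : probability (phase R N) R).
Hypotheses (phi_flow : is_flow M F phi) (phi_eq : equilibrium M phi P).
Variable u0 : phase R N -> R.
Hypothesis u0_L2 : L2 P u0.

Definition orbit_obs (t : R) (x : phase R N) : R := u0 (phi t x).

Lemma flow_measurable_at t : measurable_fun setT (phi t : phase R N -> phase R N).
Proof. exact: measurable_fun_pair2 t (flow_measurable phi_flow). Qed.

Lemma orbit_measurable (c : R -> R) : measurable_fun setT c ->
  measurable_fun [set: measurableTypeR R * phase R N] (fun z => orbit_obs (c z.1) z.2).
Proof.
move=> mc; apply: (measurableT_comp (L2_measurable u0_L2)).
apply: (measurableT_comp (flow_measurable phi_flow)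
  (g := fun z : measurableTypeR R * phase R N => (c z.1, z.2))).
by apply: measurable_fun_pair => //; exact: (measurableT_comp mc).
Qed.

Lemma L2_orbit t : 0 <= t -> L2 P (orbit_obs t).
Proof. by move=> t0; exact: (L2_comp (flow_measurable_at t) (phi_eq.2 t t0) u0_L2). Qed.

Lemma mean_orbit t : 0 <= t -> mean P (orbit_obs t) = mean P u0.
Proof. by move=> t0; exact: (mean_comp (flow_measurable_at t) (phi_eq.2 t t0) u0_L2). Qed.

Lemma nrm_orbit t : 0 <= t -> nrm P (orbit_obs t) = nrm P u0.
Proof. by move=> t0; exact: (nrm_comp (flow_measurable_at t) (phi_eq.2 t t0) u0_L2). Qed.

Variables (T : R) (rk : option nat) (lam : nat -> R) (xi : nat -> phase R N -> R).
Variable e : nat -> R -> R.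
Hypothesis T_gt0 : 0 < T.
Hypothesis kl : karhunen_loeve P T orbit_obs rk lam xi e.
Local Notation J := (is_mode rk).

Lemma expands_orbit t : t \in `[0, T] -> expands P J xi (orbit_obs t).
Proof.
move=> tT; have := kl_expansion kl tT.
by move/(L2_cvg_partial_sum (kl_lam_gt0 kl) (kl_xi_L2 kl) (kl_xi_orthonormal kl)
  (fun k => e k t)) => -[].
Qed.

Lemma inner_orbit t k : J k -> t \in `[0, T] ->
  inner P (fluct P (orbit_obs t)) (xi k) = Num.sqrt (lam k) * e k t.
Proof.
move=> Jk tT; rewrite (kl_eE kl)// mulrC divfK//.
by rewrite gt_eqF// sqrtr_gt0 (kl_lam_gt0 kl).
Qed.

(** By Pythagoras the squared residual norm is |u(s)|^2 - <u(s)>^2 minus the sum of the lam_k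
    e_k(s)^2. Equilibrium makes the first two terms constant, so measurability in time reduces to
    that of the modes e_k. *)
Lemma measurable_residual_orbit n :
  measurable_fun setT (fun s => nrm P (residual P J xi n (orbit_obs (clamp T s)))).
Proof.
have cT s := clamp_itv s (ltW T_gt0).
have c0 s : 0 <= clamp T s by have := cT s; rewrite in_itv/= => /andP[].
have -> : (fun s => nrm P (residual P J xi n (orbit_obs (clamp T s)))) =
    (fun s => Num.sqrt (nrm P u0 ^+ 2 - mean P u0 ^+ 2 -
      \sum_(k < n | J k) (Num.sqrt (lam k) * e k (clamp T s)) ^+ 2)).
  apply/funext => s; rewrite -[LHS]ger0_norm ?nrm_ge0// -sqrtr_sqr; congr Num.sqrt.
  have Lu := L2_orbit (c0 s); have LU := L2_fluct Lu.
  rewrite (sqr_nrm_subproj (kl_xi_L2 kl) (kl_xi_orthonormal kl) n LU).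
  rewrite -sqr_nrm sqr_nrm_fluct// -sqr_nrm nrm_orbit// mean_orbit//; congr (_ - _).
  by apply: eq_bigr => k Jk; rewrite inner_orbit.
apply: (measurableT_comp (continuous_measurable_fun (@sqrt_continuous R))).
apply: measurable_funB; first exact: measurable_cst.
rewrite (_ : (fun s => _) = (fun s => \sum_(k < n)
    (if J k then (Num.sqrt (lam k) * e k (clamp T s)) ^+ 2 else 0))).
  apply: measurable_sum => k; case Jk : (J k); last exact: measurable_cst.
  apply: measurable_funX; apply: measurable_funM; first exact: measurable_cst.
  apply: (measurable_comp _ _ (kl_e_measurable kl Jk)) => //.
  - by move=> _ [s _ <-]; exact: cT.
  - exact: measurable_clamp.
by apply/funext => s; rewrite big_mkcond.
Qed.

Lemma expands_memory (K : R -> R) t : t \in `[0, T] ->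
  lebesgue_measure.-integrable `[0, T] (EFin \o K) ->
  let I x := \int[lebesgue_measure]_(s in `[0, t]) (K (t - s) * orbit_obs s x) in
  L2 P I -> expands P J xi I.
Proof.
move=> tT iK I LI; have := tT; rewrite in_itv/= => /andP[t0 tleT].
have cT s := clamp_itv s (ltW T_gt0).
have c0 s : 0 <= clamp T s by have := cT s; rewrite in_itv/= => /andP[].
have subT : `[0, t]%classic `<=` (`[0, T]%classic : set R).
  by apply: subset_itvl; rewrite bnd_simp.
(* Cutting the kernel off outside [0, t] turns the memory integral into one over the whole line: t -
   s lies in [0, t] exactly when s does, and there clamping changes nothing. *)
pose k0 := K \_ (`[0, t]%classic : set R).
have ik0 : lebesgue_measure.-integrable setT (EFin \o k0).
  rewrite /k0 -restrict_EFin.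
  have iKt : lebesgue_measure.-integrable `[0, t] (EFin \o K).
    by apply: integrableS iK.
  exact: (integrable_mkcond _ _).1 iKt.
pose k s := k0 (t - s); pose U s := orbit_obs (clamp T s).
have IE : I = vint k U.
  apply/funext => x; rewrite /I /vint Rintegral_mkcond.
  apply: eq_Rintegral => s _; rewrite /k /k0 /U !patchE.
  have tsE : (t - s \in `[0, t]%classic) = (s \in `[0, t]%classic).
    rewrite !mem_setE !in_itv/=; apply/andP/andP => -[? ?]; split; lra.
  rewrite tsE; case: ifPn => [|_]; last by rewrite mul0r.
  by rewrite inE => st; rewrite clamp_id//; exact: subT.
rewrite IE in LI *.
(* The uniform bound is |u0|, since |u(s)| is constant at equilibrium. *)
apply: (expands_vint (kl_xi_L2 kl) (kl_xi_orthonormal kl) (integrable_refl t ik0)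
  (orbit_measurable (@measurable_clamp R T)) (B := nrm P u0)) => //.
- by move=> s; exact: L2_orbit.
- by move=> s; rewrite nrm_orbit.
- exact: measurable_residual_orbit.
- by move=> s; exact: expands_orbit.
Qed.

Lemma expands_fluctuation (Omega : R) (K : R -> R) (f : R -> phase R N -> R) :
  (forall t, t \in `[0, T] -> L2 P (f t)) ->
  mori_zwanzig_eq P T Omega K f orbit_obs ->
  forall t, t \in `[0, T] -> expands P J xi (f t).
Proof.
move=> Lf [iK mz] t tT; have Lft := Lf _ tT.
have u_L2 s : s \in `[0, T] -> L2 P (orbit_obs s).
  by rewrite in_itv/= => /andP[s0 _]; exact: L2_orbit.
have Lut := u_L2 _ tT; have Eut := expands_orbit tT.
pose I x := \int[lebesgue_measure]_(s in `[0, t]) (K (t - s) * orbit_obs s x).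
pose w x := Omega * orbit_obs t x + I x + f t x.
have u'w : L2_deriv_within P `[0, T] orbit_obs t w := mz _ tT.
have Lw : L2 P w by case: u'w.
have LOu : L2 P (Omega *: orbit_obs t) by exact: L2Z.
(* Square-integrability of the memory integral is read off the equation itself: [w] is an L2 limit,
   and u(t) and f(t) are in L2. *)
have IE : I = w - Omega *: orbit_obs t - f t.
  apply/funext => x.
  change (I x = Omega * orbit_obs t x + I x + f t x - Omega * orbit_obs t x - f t x).
  ring.
have LI : L2 P I by rewrite IE; exact: (L2B (L2B Lw LOu) Lft).
have EI : expands P J xi I by exact: (expands_memory tT iK LI).
have xL2 := kl_xi_L2 kl; have xON := kl_xi_orthonormal kl.
(* The difference quotients of u within [0, T] are combinations of expandable observables, and
   closedness passes to their limit [w]. *)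
have Ew : expands P J xi w.
  apply: (expands_closed xL2 xON (within_itv_dnbhs_proper T_gt0 tT) u'w).
  apply: (@filterS _ _ _ `[0, T]%classic) => [s sT|]; last exact: withinT.
  have Lus := u_L2 s sT.
  apply: (expandsZ xL2 xON _ (L2B Lus Lut)).
  exact: (expandsB xL2 Lus Lut (expands_orbit sT) Eut).
have -> : f t = w - Omega *: orbit_obs t - I by rewrite IE subKr.
apply: (expandsB xL2 (L2B Lw LOu) LI _ EI).
exact: (expandsB xL2 Lw LOu Ew (expandsZ xL2 xON _ Lut Eut)).
Qed.

End FlowOrbit.

(** * Existence and uniqueness of the expansion of the fluctuation term *)

Theorem proposition1 (R : realType) (N : nat) (M : set 'rV[R]_N)
    (F : 'rV[R]_N -> 'rV[R]_N) (phi : R -> 'rV[R]_N -> 'rV[R]_N)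
    (P : probability (phase R N) R) (T : R) (u0 : phase R N -> R)
    (etQL : R -> (phase R N -> R) -> (phase R N -> R))
    (u f : R -> phase R N -> R)
    (rk : option nat) (lam : nat -> R) (xi : nat -> phase R N -> R)
    (e : nat -> R -> R) :
  submanifold M -> is_flow M F phi -> equilibrium M phi P -> 0 < T ->
  L2 P u0 -> inner P u0 u0 != 0 -> liouville_dom P F u0 ->
  exp_semigroup P (liouville_dom P F) (QL P F u0) etQL ->
  u = (fun t x => u0 (phi t x)) ->
  f = (fun t => etQL t (QL P F u0 u0)) ->
  (forall t, t \in `[0, T] -> liouville_dom P F (f t)) ->
  mori_zwanzig_eq P T (mz_Omega P F u0) (mz_K P F u0 f) f u ->
  karhunen_loeve P T u rk lam xi e ->
  exists h : nat -> R -> R,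
    series_expansion P T rk lam xi h f /\
    forall h' : nat -> R -> R, series_expansion P T rk lam xi h' f ->
      forall k, is_mode rk k -> forall t, t \in `[0, T] -> h' k t = h k t.
Proof.
move=> _ phi_flow phi_eq T_gt0 u0_L2 _ u0_dom [C0 _] uE fE _ mz kl.
have f_L2 t : t \in `[0, T] -> L2 P (f t).
  rewrite in_itv/= fE => /andP[t0 _]; apply: (semigroup_L2 C0) => //.
  exact: L2_QL.
have {uE} uE : u = orbit_obs phi u0 by [].
rewrite {u}uE in mz kl.
have Ef := expands_fluctuation phi_flow phi_eq u0_L2 T_gt0 kl f_L2 mz.
pose h k t := inner P (fluct P (f t)) (xi k) / Num.sqrt (lam k).
(* One equivalence serves twice: from right to left it gives the expansion with modes [h], from left
   to right it forces any other modes [h'] to agree with them. *)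
have expansionP g t := L2_cvg_partial_sum (kl_lam_gt0 kl) (kl_xi_L2 kl)
  (kl_xi_orthonormal kl) (fun k => g k t) (f t).
exists h; split=> [t tT|h' h'f k Jk t tT].
  by apply: (expansionP h t).2; split=> //; [exact: f_L2|exact: Ef].
by have [_ _ ->] := (expansionP h' t).1 (h'f t tT).
Qed.
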